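(* Let $a,b\in\mathbb{R}$ with $b>1$. Then $$\pi=\frac{b^2}{F_D^{(3)}\!\left(\tfrac12;\tfrac12,\tfrac12,\tfrac12;1\,\Big|\,\dfrac1{b^4},\dfrac{e^{-2ia}}{b^2},\dfrac{e^{2ia}}{b^2}\right)}\left(\frac{K\!\left(\dfrac{2b\cos a}{1+b^2}\right)}{1+b^2}+\frac{K\!\left(\dfrac{2b\sin a}{\sqrt{1-2b^2\cos 2a+b^4}}\right)}{\sqrt{1-2b^2\cos 2a+b^4}}\right).$$
   Context: $K(k)=\int_0^1\frac{dx}{\sqrt{(1-x^2)(1-k^2x^2)}}$ is the complete elliptic integral of the first kind, as a function of the modulus $k$. The Lauricella function of $n$ variables is $F_D^{(n)}(\alpha;\beta_1,\dots,\beta_n;\gamma\,|\,x_1,\dots,x_n)=\sum_{m_1,\dots,m_n\ge0}\frac{(\alpha)_{m_1+\cdots+m_n}(\beta_1)_{m_1}\cdots(\beta_n)_{m_n}}{(\gamma)_{m_1+\cdots+m_n}\,m_1!\cdots m_n!}x_1^{m_1}\cdots x_n^{m_n}$ for $|x_j|<1$, with $(x)_k$ the Pochhammer symbol. For $\operatorname{Re}\gamma>\operatorname{Re}\alpha>0$ it equals, and outside the region of convergence is defined by analytic continuation through, $\frac{\Gamma(\gamma)}{\Gamma(\alpha)\Gamma(\gamma-\alpha)}\int_0^1\frac{u^{\alpha-1}(1-u)^{\gamma-\alpha-1}}{(1-x_1u)^{\beta_1}\cdots(1-x_nu)^{\beta_n}}\,du$ (principal branches, $x_j\notin[1,\infty)$).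 Here $i$ is the imaginary unit. *)

(* Defs.v *)
From HB Require Import structures.
From mathcomp Require Import all_boot all_order all_algebra.
From mathcomp Require Import finmap.
From mathcomp Require Import all_classical all_reals all_analysis.
From mathcomp Require summability.
From mathcomp Require Import complex.

Set Implicit Arguments.
Unset Strict Implicit.
Unset Printing Implicit Defensive.

Import Order.TTheory GRing.Theory Num.Theory.
Import numFieldNormedType.Exports.

Local Open Scope classical_set_scope.
Local Open Scope ring_scope.
Local Open Scope complex_scope.

(* A Lebesgue integral: for |k| < 1 the integrand is positive on ]0, 1[, so this
   is the improper Riemann integral. The argument k is the modulus. *)
Definition ellipticK (R : realType) (k : R) : R :=
  \int[@lebesgue_measure R]_(x in `]0, 1[)
    (Num.sqrt ((1 - x ^+ 2) * (1 - k ^+ 2 * x ^+ 2)))^-1.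

Definition cexp (R : realType) (z : R[i]) : R[i] :=
  (expR (complex.Re z))%:C * (cos (complex.Im z) +i* sin (complex.Im z)).

Definition pochhammer (F : nzRingType) (x : F) (k : nat) : F :=
  \prod_(j < k) (x + j%:R).

Definition lauricella_term (R : realType) (n : nat) (alpha : R[i])
    (beta : n.-tuple R[i]) (gamma : R[i]) (x : n.-tuple R[i])
    (m : {ffun 'I_n -> nat}) : R[i] :=
  let M := (\sum_(j < n) m j)%N in
  (pochhammer alpha M * \prod_(j < n) pochhammer (tnth beta j) (m j))
  / (pochhammer gamma M * \prod_(j < n) ((m j)`!)%:R)
  * \prod_(j < n) tnth x j ^+ m j.

(* The Lauricella series F_D^(n)(alpha; beta; gamma | x), as an unconditional sum
   over the multi-indices (the limit along the directed set of finite sets of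
   multi-indices); meaningful when all |x_j| < 1, where the series converges
   absolutely. R[i]^o is R[i] as a normed space over itself. *)
Definition lauricellaFD (R : realType) (n : nat) (alpha : R[i])
    (beta : n.-tuple R[i]) (gamma : R[i]) (x : n.-tuple R[i]) : R[i] :=
  summability.sum (lauricella_term alpha beta gamma x
                     : {ffun 'I_n -> nat} -> R[i]^o).

(* Main.v *)
Require Import Defs.
From HB Require Import structures.
From mathcomp Require Import all_boot all_order all_algebra finmap.
From mathcomp Require Import all_classical all_reals all_analysis.
From mathcomp Require Import measurable_realfun.
From mathcomp Require summability.
From mathcomp Require Import complex.
From mathcomp Require Import ring lra.

(** Put u = 1/b, q = u^2, S = sin^2 theta, and
      M(S) = 1 - q^2 S,   N(S) = |1 - q e^(2ia) S|^2 = 1 - 2 q cos(2a) S + q^2 S^2.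
    Everything reduces to the integral I of 1 / sqrt (M(S) N(S)) over a quarter
    period 0 <= theta <= pi/2.

    On one side, the Lauricella function equals (2 / pi) I: this is Euler's
    integral in the variable S ([lauricella_conj_pair]). It is obtained from
    the series itself. Wallis' formula ([wallis]) says that (1/2)_n / n! is
    2 / pi times the integral of S^n, so that the sum of the series over a box
    of multi-indices is the integral of a product of Taylor polynomials of
    (1 - z)^(-1/2) at q^2 S, q e^(-2ia) S and q e^(2ia) S. The square of such a
    polynomial tends to 1 / (1 - z), because the Cauchy square of the
    coefficients (1/2)_n / n! is constantly 1 ([half_coef_conv]); the two
    conjugate arguments contribute a squared modulus, hence 1 / |1 - z|, and no
    branch of the square root has to be followed.

    On the other side, the curve y^2 = v (q - v) (1 - q v) (1 - 2 v cos(2a) + v^2)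
    behind I, with v = q S, has generic genus 2 and the involution v -> 1/v; its
    two quotients are elliptic, and the invariants v^(-1/2) + v^(1/2) and
    v^(-1/2) - v^(1/2) lead to the substitutions
      x = (1 + q) sin theta / (1 + q S)   and   x = D sin theta / sqrt N(S),
    D = sqrt N(1). They transform K(2 u cos a / (1 + q)) / (1 + q) and
    K(2 u sin a / D) / D into the integrals of (1 - q S) / sqrt (M N) and
    (1 + q S) / sqrt (M N) ([ellipticK_cos_modulus], [ellipticK_sin_modulus]),
    whose sum is 2 I ([ellipticK_sum]). *)

Set Implicit Arguments.
Unset Strict Implicit.
Unset Printing Implicit Defensive.

Import Order.TTheory GRing.Theory Num.Theory.
Import numFieldNormedType.Exports.

Local Open Scope classical_set_scope.
Local Open Scope ring_scope.
Local Open Scope complex_scope.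

(** * The binomial series of exponent -1/2 *)

(** The Taylor coefficients at 0 of the inverse square root of 1 - z. *)
Definition half_coef (F : numFieldType) (n : nat) : F :=
  pochhammer 2^-1 n / n`!%:R.

Definition half_poly (F : numFieldType) (N : nat) : {poly F} :=
  \poly_(i < N) half_coef F i.

Section HalfCoef.
Variable F : numFieldType.
Local Notation a := (half_coef F).

Lemma pochhammerS (x : F) n : pochhammer x n.+1 = pochhammer x n * (x + n%:R).
Proof. by rewrite /pochhammer big_ord_recr. Qed.

Lemma pochhammer1 n : pochhammer (1 : F) n = n`!%:R.
Proof.
elim: n => [|n IH]; first by rewrite /pochhammer big_ord0.
by rewrite pochhammerS IH factS mulnC natrM -natr1 addrC.
Qed.

Lemma half_coefE n : a n = pochhammer 2^-1 n / n`!%:R.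
Proof. by []. Qed.

Lemma half_coef0 : a 0 = 1.
Proof. by rewrite /half_coef /pochhammer big_ord0 divr1. Qed.

Lemma half_coefS n : n.+1%:R * a n.+1 = (n%:R + 2^-1) * a n.
Proof.
have n0 : n.+1%:R != 0 :> F by rewrite pnatr_eq0.
have f0 : n`!%:R != 0 :> F by rewrite pnatr_eq0 -lt0n fact_gt0.
rewrite /half_coef pochhammerS factS natrM.
by field; rewrite f0 nat1r n0.
Qed.

Lemma half_coefSE n : a n.+1 = (n%:R + 2^-1) / n.+1%:R * a n.
Proof.
have n0 : n.+1%:R != 0 :> F by rewrite pnatr_eq0.
by apply: (mulfI n0); rewrite half_coefS [RHS]mulrA (mulrC n.+1%:R) divfK.
Qed.

Lemma half_coef_ge0 n : 0 <= a n.
Proof.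
elim: n => [|n IH]; first by rewrite half_coef0.
by rewrite half_coefSE mulr_ge0// divr_ge0// addr_ge0// invr_ge0.
Qed.

Lemma half_coef_le1 n : a n <= 1.
Proof.
elim: n => [|n IH]; first by rewrite half_coef0.
rewrite half_coefSE mulr_ile1 ?half_coef_ge0//.
by rewrite ler_pdivrMr ?ltr0n// mul1r -[leRHS]natr1 lerD2l invf_le1 ?ltr0n// ler1n.
Qed.

(* Otherwise conversion tests unfold the product defining the coefficients. *)
Opaque half_coef.

(** The Cauchy square of the series is the geometric series. Writing s n for
    the sum below, the symmetry i <-> n - i turns the sum weighted by i into
    n / 2 times s n; the recurrence of the coefficients then yields
    (n + 1) s (n + 1) = (n + 1) s n. *)
Lemma half_coef_conv n : \sum_(i < n.+1) a i * a (n - i)%N = 1.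
Proof.
pose s n := \sum_(i < n.+1) a i * a (n - i)%N.
pose t n := \sum_(i < n.+1) i%:R * (a i * a (n - i)%N).
have ts m : 2 * t m = m%:R * s m.
  have -> : 2 * t m = t m + t m by ring.
  rewrite {2}/t (reindex_inj rev_ord_inj)/= -big_split/= mulr_sumr.
  apply: eq_bigr => i _; have im : (i <= m)%N by rewrite -ltnS.
  by rewrite subSS (subKn im) [X in _ + _ * X]mulrC -mulrDl -natrD (subnKC im).
have tS m : t m.+1 = t m + s m / 2.
  rewrite /t big_ord_recl/= mul0r add0r mulr_suml -big_split/=.
  apply: eq_bigr => i _; rewrite /bump/= add1n subSS mulrA half_coefS; ring.
elim: n => [|n IH]; first by rewrite big_ord1 half_coef0 mulr1.
have n0 : n.+1%:R != 0 :> F by rewrite pnatr_eq0.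
apply: (mulfI n0); rewrite -/(s n.+1) -ts tS -/(s n) in IH *.
by rewrite mulrDr ts mulrCA IH -natr1; field.
Qed.

(** Below degree N the truncation does not affect the Cauchy square, whose
    coefficients are then 1; from N on it only removes nonnegative terms. *)
Lemma half_poly_sqr N k :
  ((k < N)%N -> (half_poly F N ^+ 2)`_k = 1) /\ 0 <= (half_poly F N ^+ 2)`_k <= 1.
Proof.
have c0 i : 0 <= (half_poly F N)`_i <= a i.
  by rewrite coef_poly; case: ifP; rewrite ?lexx half_coef_ge0.
have ce : (half_poly F N ^+ 2)`_k
    = \sum_(i < k.+1) (half_poly F N)`_i * (half_poly F N)`_(k - i).
  by rewrite expr2 coefM.
split=> [kN|].
  rewrite ce -[RHS](half_coef_conv k); apply: eq_bigr => i _.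
  rewrite !coef_poly (leq_ltn_trans _ kN) 1?(leq_ltn_trans _ kN)//.
    exact: leq_subr.
  by rewrite -ltnS.
rewrite ce sumr_ge0/= => [|i _]; last first.
  by rewrite mulr_ge0//; [case/andP: (c0 i) | case/andP: (c0 (k - i)%N)].
rewrite -(half_coef_conv k); apply: ler_sum => i _.
have /andP[? ?] := c0 i; have /andP[? ?] := c0 (k - i)%N.
exact: ler_pM.
Qed.

(** The square of the Taylor polynomial exceeds the geometric polynomial by terms
    of degree at least N with coefficients in [0, 1]. This controls the limit of
    the square without choosing a branch of the square root of 1 - z. *)
Lemma half_poly_sqr_approx N (z r : F) : `|z| <= r -> r < 1 ->
  `|(half_poly F N).[z] ^+ 2 - (1 - z)^-1| <= 2 * r ^+ N / (1 - r).
Proof.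
move=> zr r1.
have r0 : 0 <= r by apply: le_trans zr.
have z1 : `|z| < 1 by apply: le_lt_trans r1.
have z1' : 1 - z != 0.
  by apply: contraTneq z1 => /subr0_eq <-; rewrite normr1 ltxx.
have r1' : 0 < 1 - r by rewrite subr_gt0.
have geo (x : F) m : x != 1 -> \sum_(k < m) x ^+ k = (1 - x ^+ m) / (1 - x).
  move=> x1; have x1' : 1 - x != 0 by rewrite subr_eq0 eq_sym.
  by apply: (mulIf x1'); rewrite divfK// -[1 - x ^+ m]opprB subrX1; ring.
have sz : (size (half_poly F N ^+ 2) <= N + N)%N.
  apply: (leq_trans (size_polyMleq _ _)); apply: (leq_trans (leq_pred _)).
  by apply: leq_add; exact: size_poly.
rewrite -horner_exp (horner_coef_wide _ sz) big_split_ord/=.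
rewrite (eq_bigr (fun i : 'I_N => z ^+ i)); last first.
  by move=> i _; case: (half_poly_sqr N i) => -> //; rewrite mul1r.
have zne : z != 1 by rewrite eq_sym -subr_eq0.
rewrite (geo z N zne) mulrBl mul1r addrC addrA addrAC addrK addrC.
apply: (le_trans (ler_normD _ _)); rewrite normrN normrM normfV normrX.
rewrite mulrDl mulrDl !mul1r lerD//.
  rewrite ler_pM ?exprn_ge0 ?invr_ge0 ?lerXn2r// ?nnegrE//.
  rewrite lef_pV2 ?posrE ?normr_gt0//.
  apply: le_trans (lerB_dist _ _); rewrite normr1 lerD2l lerN2//.
apply: (le_trans (ler_norm_sum _ _ _)).
apply: (@le_trans _ _ (r ^+ N * \sum_(i < N) r ^+ i)).
  rewrite mulr_sumr; apply: ler_sum => i _.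
  have [_ /andP[c0 c1]] := half_poly_sqr N (N + i).
  rewrite -exprD normrM normrX ger0_norm// -[leRHS]mul1r.
  by rewrite ler_pM ?exprn_ge0// lerXn2r// nnegrE.
rewrite ler_wpM2l ?exprn_ge0// geo ?lt_eqF//.
by rewrite ler_pdivrMr// mulVf ?gt_eqF// lerBlDr lerDl exprn_ge0.
Qed.

Lemma half_poly_ge0 N (x : F) : 0 <= x -> 0 <= (half_poly F N).[x].
Proof.
move=> x0; rewrite horner_poly sumr_ge0// => i _.
by rewrite mulr_ge0 ?half_coef_ge0// exprn_ge0.
Qed.

Lemma half_poly_norm_le N (z r : F) : `|z| <= r -> r < 1 ->
  `|(half_poly F N).[z]| <= (1 - r)^-1.
Proof.
move=> zr r1.
have r0 : 0 <= r by apply: le_trans zr.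
have r1' : 0 < 1 - r by rewrite subr_gt0.
rewrite horner_poly; apply: (le_trans (ler_norm_sum _ _ _)).
apply: (@le_trans _ _ (\sum_(i < N) r ^+ i)).
  apply: ler_sum => i _; rewrite normrM normrX ger0_norm ?half_coef_ge0//.
  rewrite -[leRHS]mul1r ler_pM ?half_coef_ge0 ?half_coef_le1 ?exprn_ge0//.
  by rewrite lerXn2r// nnegrE.
rewrite -(ler_pM2l r1') mulfV ?gt_eqF// -[leLHS]opprK -mulNr opprB -subrX1 opprB.
by rewrite lerBlDr lerDl exprn_ge0.
Qed.
End HalfCoef.

Opaque half_coef.

Lemma map_half_coef (F F' : numFieldType) (f : {rmorphism F -> F'}) n :
  f (half_coef F n) = half_coef F' n.
Proof.
elim: n => [|n IH]; first by rewrite !half_coef0 rmorph1.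
rewrite !half_coefSE (rmorphM f) IH fmorph_div rmorphD fmorphV !rmorph_nat.
by [].
Qed.

Lemma map_half_poly (F F' : numFieldType) (f : {rmorphism F -> F'}) N x :
  f (half_poly F N).[x] = (half_poly F' N).[f x].
Proof.
rewrite !horner_poly rmorph_sum; apply: eq_bigr => i _.
by rewrite rmorphM rmorphXn map_half_coef.
Qed.

Section HalfPolyLimits.
Variable R : realType.

Lemma normc_real (x : R) : `|x%:C| = `|x|%:C.
Proof. by rewrite normc_def/= expr0n addr0 sqrtr_sqr. Qed.

Lemma geometric_squeeze (u : nat -> R) (l K r : R) : 0 <= r < 1 ->
  (forall N, `|u N - l| <= K * r ^+ N) -> u @ \oo --> l.
Proof.
move=> /andP[r0 r1] ul; apply/subr_cvg0.
apply: (@norm_cvg0 _ R).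
apply: (@squeeze_cvgr _ _ _ _ (cst 0) (fun N => K * r ^+ N)).
- by near=> N; rewrite normr_ge0/= ul.
- exact: cvg_cst.
- rewrite -[X in _ --> X](mulr0 K); apply: cvgM; first exact: cvg_cst.
  by apply: cvg_expr; rewrite ger0_norm.
Unshelve. all: end_near. Qed.

(** The modulus of the square is the square of the modulus, so the approximation
    of the square is enough. *)
Lemma half_poly_cvg_norm (z : R[i]) (r : R) : `|z| <= r%:C -> r < 1 ->
  complex.Re `|(half_poly R[i] N).[z]| ^+ 2 @[N --> \oo] --> (complex.Re `|1 - z|)^-1.
Proof.
move=> zr r1.
have r0 : 0 <= r by rewrite -ler0c (le_trans _ zr).
apply: (@geometric_squeeze _ _ (2 / (1 - r)) r) => [|N]; first by rewrite r0.
have r1' : r%:C < 1 by rewrite -(rmorph1 (real_complex R)) ltcR.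
have nE (w : R[i]) : `|w| = (complex.Re `|w|)%:C by rewrite RRe_real ?normr_real.
have := le_trans (ler_dist_dist _ _) (half_poly_sqr_approx N zr r1').
rewrite normrX normfV (nE (1 - z)) (nE (_.[z])) -rmorphXn -fmorphV -rmorphB/=.
rewrite normc_real => h; rewrite -lecR (le_trans h)//.
by rewrite !rmorphM !fmorphV rmorphB rmorphXn rmorph1 rmorph_nat mulrAC.
Qed.

Lemma half_poly_cvg (x : R) : 0 <= x < 1 ->
  (half_poly R N).[x] @[N --> \oo] --> (Num.sqrt (1 - x))^-1.
Proof.
move=> /andP[x0 x1].
rewrite -sqrtrV ?subr_ge0 1?ltW//.
rewrite (_ : (fun N => _) = (fun N => Num.sqrt ((half_poly R N).[x] ^+ 2))); last first.
  by apply/funext => N; rewrite sqrtr_sqr ger0_norm// half_poly_ge0.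
apply: (cvg_comp _ (@Num.sqrt R) _ (@sqrt_continuous R _)).
apply: (@geometric_squeeze _ _ (2 / (1 - x)) x) => [|N]; first by rewrite x0.
by rewrite mulrAC; apply: half_poly_sqr_approx => //; rewrite ger0_norm.
Qed.

End HalfPolyLimits.

(** * Unconditional sums *)

(** An absolutely dominated family is summed along any exhaustion of its index
    set by finite sets: beyond a large [box n], every finite partial sum differs
    from the one over [box n] by at most the tail of the dominating series. *)
Lemma sum_exhaustion (R : realType) (I : choiceType) (f : I -> R[i])
    (g : I -> R) (box : nat -> {fset I}) (r : nat -> R) (l G : R) :
  (forall i, `|f i| <= (g i)%:C) ->
  {homo box : m n / (m <= n)%N >-> (m `<=` n)%fset} ->
  (forall i, exists n, i \in box n) ->
  (\sum_(i <- box n) g i) @[n --> \oo] --> G ->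
  (forall n, \sum_(i <- box n) f i = (r n)%:C) ->
  r @ \oo --> l ->
  summability.sum (f : I -> R[i]^o) = l%:C.
Proof.
move=> fg box_homo box_exh gG fr rl.
have g0 i : 0 <= g i by rewrite -ler0c (le_trans _ (fg i)).
have sub_sum (V : zmodType) (h : I -> V) (A B : {fset I}) : (A `<=` B)%fset ->
    \sum_(i <- B) h i = \sum_(i <- A) h i + \sum_(i <- (B `\` A)%fset) h i.
  move=> AB; rewrite (big_fsetID _ (mem A))/=; congr (_ + _); apply: eq_fbigl => i.
    rewrite !inE/=; case: (boolP (i \in A)) => iA; rewrite ?andbF// andbT.
    by rewrite (fsubsetP AB).
  by rewrite !inE/= andbC.
have boxA (A : {fset I}) : exists n, (A `<=` box n)%fset.
  have [b bP] : {b : I -> nat | forall i, i \in box (b i)}.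
    exists (fun i => xchoose (box_exh i)) => i; exact: (xchooseP (box_exh i)).
  exists (\max_(i <- A) b i); apply/fsubsetP => i iA.
  by apply: fsubsetP (bP i); apply: box_homo; rewrite (big_fsetD1 i iA)/= leq_maxl.
have gle n : \sum_(i <- box n) g i <= G.
  rewrite -(cvg_lim (@Rhausdorff R) gG).
  apply: nondecreasing_cvgn_le; last exact: cvgP gG.
  move=> m k mk; rewrite (sub_sum _ g _ _ (box_homo _ _ mk)) lerDl.
  exact: sumr_ge0.
have PF := @summability.totally_filter I.
apply: cvg_lim; first exact: norm_hausdorff.
apply/cvgrPdist_lt => e0 e00.
have [e e0E e_gt0] : exists2 e : R, e0 = e%:C & 0 < e.
  move: e00; rewrite ltcE/= => /andP[/eqP e0i e0r].
  by exists (complex.Re e0) => //; case: e0 e0i {e0r} => ? ? /= ->.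
rewrite e0E {e0 e00 e0E}.
have e2 : 0 < e / 2 by rewrite divr_gt0.
have [n [nG nl]] : exists n, G - \sum_(i <- box n) g i < e / 2 /\ `|l - r n| < e / 2.
  move/cvgrPdist_lt : gG => /(_ _ e2) gG; move/cvgrPdist_lt : rl => /(_ _ e2) rl.
  have [n _ /(_ n (leqnn n))/= [? ?]] := filterI gG rl; exists n; split=> //.
  exact: le_lt_trans (ler_norm _) _.
exists (box n) => // A /= nA.
rewrite /summability.partial_sum -(big_seq_fsetE _ _ xpredT f).
rewrite (sub_sum _ f _ _ nA) fr opprD addrA.
apply: le_lt_trans (ler_normB _ _) _.
rewrite -rmorphB normc_real [e]splitr rmorphD/=.
apply: ltr_leD; first by rewrite ltcR.
apply: (@le_trans _ _ (\sum_(i <- (A `\` box n)%fset) g i)%:C).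
  rewrite rmorph_sum; apply: (le_trans (ler_norm_sum _ _ _)).
  by apply: ler_sum => i _; exact: fg.
rewrite lecR; have [m Am] := boxA A.
apply: (@le_trans _ _ (G - \sum_(i <- box n) g i)); last exact: ltW.
rewrite lerBrDl -(sub_sum _ g _ _ nA).
apply: le_trans (gle m); rewrite (sub_sum _ g _ _ Am) lerDl.
exact: sumr_ge0.
Qed.

(** * Integrals over a quarter period *)

Section QuarterPeriod.
Variable R : realType.
Local Notation mu := (@lebesgue_measure R).

Lemma is_derive_continuous (F F' : R -> R) :
  (forall x : R, is_derive x 1 F (F' x)) -> continuous F.
Proof.
move=> dF x; apply: differentiable_continuous; apply/derivable1_diffP.
by have [] := dF x.
Qed.

Lemma continuous_inv_fun (f : R -> R) : (forall t, 0 < f t) -> continuous f ->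
  continuous (fun t => (f t)^-1).
Proof. by move=> f0 cf t; apply: cvgV; [rewrite gt_eqF | exact: cf]. Qed.

Lemma continuous_sqrt_fun (f : R -> R) : continuous f ->
  continuous (fun t => Num.sqrt (f t)).
Proof.
move=> cf t; apply: (@continuous_comp _ _ _ f (@Num.sqrt R)); first exact: cf.
exact: sqrt_continuous.
Qed.

Lemma continuous_exp_fun (f : R -> R) n : continuous f ->
  continuous (fun t => f t ^+ n).
Proof.
move=> cf t; apply: (@continuous_comp _ _ _ f (fun y => y ^+ n)); first exact: cf.
exact: exprn_continuous.
Qed.

Lemma continuous_sinX n : continuous (fun t : R => sin t ^+ n).
Proof. by apply: continuous_exp_fun; exact: continuous_sin. Qed.

Lemma continuous_comp_sin2 (f : R -> R) : continuous f ->
  continuous (fun t : R => f (sin t ^+ 2)).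
Proof.
move=> cf t; apply: (@continuous_comp _ _ _ (fun t : R => sin t ^+ 2) f).
  exact: continuous_sinX.
exact: cf.
Qed.

Lemma is_deriveM_fun (f g : R -> R) (x df dg : R) : is_derive x 1 f df ->
  is_derive x 1 g dg -> is_derive x 1 (fun t => f t * g t) (f x * dg + g x * df).
Proof. exact: is_deriveM. Qed.

Lemma is_deriveV_fun (f : R -> R) (x df : R) : f x != 0 -> is_derive x 1 f df ->
  is_derive x 1 (fun t => (f t)^-1) (- (f x) ^- 2 * df).
Proof. by move=> fx; exact: is_deriveV. Qed.

Lemma is_derive_exp_fun (f : R -> R) n (x df : R) : is_derive x 1 f df ->
  is_derive x 1 (fun t => f t ^+ n) (n%:R * f x ^+ n.-1 * df).
Proof.
move=> dfx; have := is_deriveX n dfx.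
by rewrite exprfctE.
Qed.

Lemma is_derive_sin2 (p : {poly R}) (t : R) :
  is_derive t 1 (fun t => p.[sin t ^+ 2])
    ((deriv p).[sin t ^+ 2] * (2 * sin t * cos t)).
Proof.
have := @is_derive1_comp R (horner p) (fun t => sin t ^+ 2) t _ _
  (is_derive_poly p (sin t ^+ 2))
  (is_derive_exp_fun 2 (is_derive_sin t)).
by rewrite /= expr1.
Qed.

Lemma sin2_01 (t : R) : 0 <= sin t ^+ 2 <= 1.
Proof. by rewrite sqr_ge0/= sin2cos2 lerBlDr lerDl sqr_ge0. Qed.

Lemma pihalf_gt0 : 0 < pi / 2 :> R.
Proof. by rewrite divr_gt0// pi_gt0. Qed.

Lemma cos_gt0_quarter (t : R) : 0 < t < pi / 2 -> 0 < cos t.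
Proof.
move=> /andP[t0 t1].
by rewrite cos_gt0_pihalf// (lt_trans _ t0)// oppr_lt0 pihalf_gt0.
Qed.

Lemma continuous_integrable_itvcc (f : R -> R) (a b : R) :
  continuous f -> mu.-integrable `[a, b] (EFin \o f).
Proof.
move=> cf; apply: continuous_compact_integrable; first exact: segment_compact.
exact: continuous_subspaceT.
Qed.

Lemma Rintegral_is_derive (F f : R -> R) (a b : R) : a < b ->
  (forall x : R, is_derive x 1 F (f x)) -> continuous f ->
  \int[mu]_(x in `[a, b]) f x = F b - F a.
Proof.
move=> ab dF cf.
have cF := is_derive_continuous dF.
rewrite /Rintegral (@continuous_FTC2 _ f F)//.
- exact: continuous_subspaceT.
- split; [|apply: cvg_at_right_filter; exact: cF|apply: cvg_at_left_filter; exact: cF].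
  by move=> x _; have [] := dF x.
- by move=> x _; rewrite derive1E; have [_ ] := dF x.
Qed.

(** Integrating the derivative of sin^(2n+1) cos over a quarter period gives 0,
    which is the recurrence of [half_coef]. *)
Lemma wallis n :
  \int[mu]_(t in `[0, pi / 2]) (sin t ^+ n.*2) = pi / 2 * half_coef R n.
Proof.
elim: n => [|n IH].
  rewrite half_coef0 mulr1 (@Rintegral_is_derive id) ?pihalf_gt0 ?subr0//.
  exact: continuous_sinX.
have n0 : n.+1.*2%:R != 0 :> R by rewrite pnatr_eq0.
have n0' : n.+1%:R != 0 :> R by rewrite pnatr_eq0.
pose f (t : R) := n.*2.+1%:R * sin t ^+ n.*2 - n.+1.*2%:R * sin t ^+ n.+1.*2.
have cM c k : continuous (fun t : R => c * sin t ^+ k).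
  by move=> x; apply: cvgM; [exact: cvg_cst | exact: continuous_sinX].
have cf : continuous f by move=> x; apply: cvgB; exact: cM.
have : \int[mu]_(t in `[0, pi / 2]) f t = 0.
  apply: (etrans (@Rintegral_is_derive (fun t => sin t ^+ n.*2.+1 * cos t) f _ _
    pihalf_gt0 _ cf)); last first.
    by rewrite cos_pihalf sin0 expr0n/= mul0r mulr0 subrr.
  move=> x; have dX := is_derive_exp_fun n.*2.+1 (is_derive_sin x).
  apply: (is_derive_eq (is_deriveM dX (is_derive_cos x))).
  rewrite /f /GRing.scale/= -![_.*2.+1%:R]natr1 doubleS -![_.+1%:R]natr1 !exprS.
  have cs : cos x * cos x = 1 - sin x * sin x by rewrite -!expr2 cos2sin2.
  transitivity ((n.*2%:R + 1) * sin x ^+ n.*2 * (cos x * cos x)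
     - sin x ^+ n.*2 * (sin x * sin x)); first by ring.
  rewrite cs; ring.
have iM c k := @continuous_integrable_itvcc _ 0 (pi / 2) (cM c k).
have iX k := @continuous_integrable_itvcc _ 0 (pi / 2) (@continuous_sinX k).
rewrite RintegralB//; [|exact: iM..].
rewrite !RintegralZl//; [|exact: iX..].
move=> /eqP; rewrite subr_eq0 IH => /eqP e.
apply: (mulfI n0); rewrite -e.
have -> : n.+1.*2%:R = 2 * n.+1%:R :> R by rewrite -mul2n natrM.
rewrite [RHS]mulrCA -(mulrA 2) half_coefS -natr1 -mul2n natrM.
by field.
Qed.

Lemma integral_sin2_sum (J : finType) (d : J -> R) (e : J -> nat) :
  \int[mu]_(t in `[0, pi / 2]) (\sum_j d j * (sin t ^+ 2) ^+ e j)
   = pi / 2 * \sum_j d j * half_coef R (e j).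
Proof.
have ci j : mu.-integrable `[0, pi / 2] (EFin \o (fun t => d j * sin t ^+ (e j).*2)).
  apply: continuous_integrable_itvcc => x.
  by apply: cvgM; [exact: cvg_cst | exact: continuous_sinX].
rewrite /Rintegral.
transitivity (fine (\int[mu]_(t in `[0%R, (pi / 2)%R])
    (\sum_j (d j * sin t ^+ (e j).*2)%:E))%E).
  congr fine; apply: eq_integral => t _; rewrite sumEFin.
  by under eq_bigr do rewrite -exprM mul2n.
rewrite integral_sum//.
rewrite (eq_bigr (fun j => (pi / 2 * (d j * half_coef R (e j)))%:E)).
  by rewrite sumEFin/= mulr_sumr.
move=> j _; rewrite mulrCA -wallis -RintegralZl//.
  by rewrite /Rintegral fineK//; apply: integrable_fin_num => //; exact: ci.
by apply: continuous_integrable_itvcc; exact: continuous_sinX.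
Qed.

Lemma cvg_Rintegral_dominated (f_ : nat -> R -> R) (f : R -> R) (a b K : R) :
  (forall n, continuous (f_ n)) -> continuous f ->
  (forall x, a <= x <= b -> f_ n x @[n --> \oo] --> f x) ->
  (forall n x, a <= x <= b -> `|f_ n x| <= K) ->
  \int[mu]_(x in `[a, b]) f_ n x @[n --> \oo] --> \int[mu]_(x in `[a, b]) f x.
Proof.
move=> cf_ cf f_f f_K; rewrite /Rintegral; apply: fine_cvg.
rewrite fineK; last first.
  by apply: integrable_fin_num => //; exact: continuous_integrable_itvcc.
apply: (@dominated_cvg _ _ _ mu _ _ _ _ (EFin \o cst K)) => //.
- move=> n; apply/measurable_EFinP; apply: measurable_funTS.
  exact: continuous_measurable_fun.
- move=> x; rewrite /= in_itv/= => xab; apply: cvg_EFin; last exact: f_f.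
  by near=> n.
- by apply: continuous_integrable_itvcc => x; exact: cvg_cst.
Unshelve. all: end_near. Qed.

End QuarterPeriod.

(** * Lauricella series with all parameters 1/2 *)

Section LauricellaIntegral.
Variable R : realType.
Local Notation mu := (@lebesgue_measure R).
Local Notation C := R[i].

(** A complex combination of monomials with real values has real and imaginary
    parts to which [integral_sin2_sum] applies; no complex integral is needed. *)
Lemma wallis_sum (J : finType) (c : J -> C) (e : J -> nat) (p : R -> R) :
  (forall s, \sum_j c j * (s ^+ e j)%:C = (p s)%:C) ->
  (pi / 2)%:C * \sum_j c j * half_coef C (e j)
    = (\int[mu]_(t in `[0, pi / 2]) p (sin t ^+ 2))%:C
  /\ (forall s, p s = \sum_j complex.Re (c j) * s ^+ e j).
Proof.
move=> cp.
have ReM (x : C) y : complex.Re (x * y%:C) = complex.Re x * y.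
  by case: x => u v /=; rewrite mulr0 subr0.
have ImM (x : C) y : complex.Im (x * y%:C) = complex.Im x * y.
  by case: x => u v /=; rewrite mulr0 add0r.
have ReS (F : J -> C) : complex.Re (\sum_j F j) = \sum_j complex.Re (F j).
  by apply: (big_morph (@complex.Re R)) => // -[? ?] [? ?].
have ImS (F : J -> C) : complex.Im (\sum_j F j) = \sum_j complex.Im (F j).
  by apply: (big_morph (@complex.Im R)) => // -[? ?] [? ?].
have Rep s : p s = \sum_j complex.Re (c j) * s ^+ e j.
  have -> : p s = complex.Re (\sum_j c j * (s ^+ e j)%:C) by rewrite cp.
  rewrite ReS.
  by apply: eq_bigr => j _; rewrite ReM.
have Imp s : \sum_j complex.Im (c j) * s ^+ e j = 0.
  transitivity (complex.Im (\sum_j c j * (s ^+ e j)%:C)); last by rewrite cp.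
  rewrite ImS.
  by apply: eq_bigr => j _; rewrite ImM.
split=> //.
under eq_bigr do rewrite -(map_half_coef (real_complex R)).
rewrite mulrC; apply/eqP; rewrite eq_complex ReM ImM ReS ImS; apply/andP; split.
  under eq_bigr do rewrite ReM.
  rewrite mulrC -integral_sin2_sum; apply/eqP.
  by apply: eq_Rintegral => t _; rewrite -Rep.
under eq_bigr do rewrite ImM.
rewrite mulrC -integral_sin2_sum (_ : (fun t => _) = cst 0)/=.
  by rewrite /Rintegral integral0.
by apply/funext => t; rewrite Imp.
Qed.

Lemma lauricella_term_half n (beta x : n.-tuple C) (m : {ffun 'I_n -> nat}) :
  (forall i, tnth beta i = 2^-1) ->
  lauricella_term 2^-1 beta 1 x m = \prod_j (half_coef C (m j) * tnth x j ^+ m j)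
    * half_coef C (\sum_j m j).
Proof.
move=> b2; rewrite /lauricella_term pochhammer1 half_coefE big_split/=.
have -> : \prod_j half_coef C (m j)
    = (\prod_j pochhammer 2^-1 (m j)) / \prod_j (m j)`!%:R.
  by rewrite -prodf_div; apply: eq_bigr => j _; rewrite half_coefE.
have -> : \prod_j pochhammer (tnth beta j) (m j) = \prod_j pochhammer 2^-1 (m j).
  by apply: eq_bigr => j _; rewrite b2.
by rewrite invfM; ring.
Qed.

Definition multi_index n N (g : {ffun 'I_n -> 'I_N}) : {ffun 'I_n -> nat} :=
  [ffun i => val (g i)].

Definition box n N : {fset {ffun 'I_n -> nat}} :=
  [fset multi_index g | g in {: {ffun 'I_n -> 'I_N}}]%fset.

Lemma in_box n N (m : {ffun 'I_n -> nat}) :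
  (m \in box n N) = [forall i, (m i < N)%N].
Proof.
apply/imfsetP/forallP => [[g _ ->] i|mN]; first by rewrite ffunE ltn_ord.
exists [ffun i => Ordinal (mN i)] => //.
by apply/ffunP => i; rewrite !ffunE.
Qed.

Lemma sum_box (V : zmodType) n N (F : {ffun 'I_n -> nat} -> V) :
  \sum_(m <- box n N) F m = \sum_(g : {ffun 'I_n -> 'I_N}) F (multi_index g).
Proof.
rewrite big_imfset/= ?big_enum//= => g h _ _ /ffunP gh.
by apply/ffunP => i; apply: val_inj; have := gh i; rewrite !ffunE.
Qed.

Lemma box_homo n : {homo box n : M N / (M <= N)%N >-> (M `<=` N)%fset}.
Proof.
move=> M N MN; apply/fsubsetP => m; rewrite !in_box => /forallP mM.
by apply/forallP => i; exact: leq_trans MN.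
Qed.

Lemma box_exhausts n (m : {ffun 'I_n -> nat}) : exists N, m \in box n N.
Proof.
exists (\max_i m i).+1; rewrite in_box; apply/forallP => i.
by rewrite ltnS; exact: (leq_bigmax i).
Qed.

Lemma prod_box (F : comPzRingType) n N (c : nat -> 'I_n -> F) :
  \sum_(g : {ffun 'I_n -> 'I_N}) \prod_i c (g i) i = \prod_i \sum_(k < N) c k i.
Proof. by rewrite bigA_distr_bigA. Qed.

(** Euler's integral in the variable sin^2 t. The partial sum of the series over the
    box of size N is the integral of the product of the Taylor polynomials of the
    factors, by [wallis_sum]; [p] records that this product is real, and the
    integrals converge by domination. *)
Lemma lauricella_half_integral n (beta x : n.-tuple C) (r : R)
    (p : nat -> R -> R) (H : R -> R) :
  (forall i, tnth beta i = 2^-1) ->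
  (forall i, `|tnth x i| <= r%:C) -> 0 <= r < 1 ->
  (forall N s, \prod_i (half_poly C N).[tnth x i * s%:C] = (p N s)%:C) ->
  (forall s, 0 <= s <= 1 -> p N s @[N --> \oo] --> H s) ->
  continuous (fun t : R => H (sin t ^+ 2)) ->
  lauricellaFD 2^-1 beta 1 x
    = (2 / pi * \int[mu]_(t in `[0, pi / 2]) H (sin t ^+ 2))%:C.
Proof.
move=> b2 xr /andP[r0 r1] pE pH cH.
have pi0 : pi != 0 :> R by rewrite gt_eqF// pi_gt0.
pose c N (g : {ffun 'I_n -> 'I_N}) : C :=
  \prod_i (half_coef C (g i) * tnth x i ^+ g i).
have cp N s : \sum_g c N g * (s ^+ (\sum_i g i))%:C = (p N s)%:C.
  rewrite -pE (eq_bigr (fun i => \sum_(k < N) half_coef C k * tnth x i ^+ k * s%:C ^+ k)).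
    rewrite -(prod_box N (fun k i => half_coef C k * tnth x i ^+ k * s%:C ^+ k)).
    by apply: eq_bigr => g _; rewrite big_split/= rmorphXn expr_sum.
  move=> i _; rewrite horner_poly; apply: eq_bigr => k _.
  by rewrite exprMn mulrA.
have {}cp N := wallis_sum (cp N).
have sin01 := @sin2_01 R.
rewrite /lauricellaFD.
apply: (sum_exhaustion (f := lauricella_term 2^-1 beta 1 x)
  (g := fun m => \prod_i r ^+ m i) (box := box n)
  (r := fun N => 2 / pi * \int[mu]_(t in `[0, pi / 2]) p N (sin t ^+ 2))
  (G := \prod_(i < n) (1 - r)^-1)).
- move=> m; rewrite lauricella_term_half// normrM normr_prod -[leRHS]mulr1.
  rewrite ler_pM ?prodr_ge0//.
  + rewrite rmorph_prod; apply: ler_prod => i _; rewrite normr_ge0/= normrM normrX.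
    rewrite rmorphXn ger0_norm ?half_coef_ge0// -[leRHS]mul1r.
    by rewrite ler_pM ?half_coef_ge0 ?half_coef_le1 ?exprn_ge0// lerXn2r// nnegrE ler0c.
  + by rewrite ger0_norm ?half_coef_ge0 ?half_coef_le1.
- exact: box_homo.
- exact: box_exhausts.
- under eq_fun => N.
    rewrite sum_box (eq_bigr (fun g : {ffun 'I_n -> 'I_N} => \prod_i r ^+ g i)); last first.
      by move=> g _; apply: eq_bigr => i _; rewrite ffunE.
    rewrite (prod_box N (fun k i => r ^+ k)) prodr_const.
    over.
  have geo : \sum_(k < N) r ^+ k @[N --> \oo] --> (1 - r)^-1.
    have := @cvg_geometric_series R 1 r; rewrite ger0_norm// mul1r => /(_ r1).
    apply: cvg_trans; apply: near_eq_cvg; near=> N.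
    by rewrite /series/= big_mkord; apply: eq_bigr => k _; rewrite /geometric/= mul1r.
  rewrite prodr_const.
  exact: (cvg_comp _ (fun y : R => y ^+ #|'I_n|) geo (@exprn_continuous R _ _)).
- move=> N; have [+ _] := cp N; move=> cpN.
  rewrite sum_box rmorphM/= -cpN mulrA -rmorphM/=.
  have -> : 2 / pi * (pi / 2) = 1 :> R by rewrite mulrA divfK ?divff ?pnatr_eq0.
  rewrite mul1r; apply: eq_bigr => g _; rewrite lauricella_term_half//.
  congr (_ * _); first by apply: eq_bigr => i _; rewrite ffunE.
  by congr half_coef; apply: eq_bigr => i _; rewrite ffunE.
apply: cvgM; first exact: cvg_cst.
apply: (@cvg_Rintegral_dominated R _ _ _ _ (\prod_(i < n) (1 - r)^-1)) => //.
- move=> N; have [_ pN] := cp N.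
  rewrite (_ : (fun _ => _) = (fun t : R =>
    (\sum_g complex.Re (c N g) *: 'X^(\sum_i g i)).[sin t ^+ 2])).
    move=> t; apply: (@continuous_comp _ _ _ (fun t : R => sin t ^+ 2)
      (horner (\sum_g complex.Re (c N g) *: 'X^(\sum_i g i)))).
      exact: continuous_sinX.
    exact: continuous_horner.
  apply/funext => t; rewrite pN horner_sum; apply: eq_bigr => g _.
  by rewrite hornerZ hornerXn.
- by move=> t _; exact: pH.
- move=> N t _; rewrite -lecR -normc_real -pE normr_prod rmorph_prod.
  apply: ler_prod => i _; rewrite normr_ge0/= fmorphV rmorphB rmorph1.
  apply: half_poly_norm_le; last by rewrite -(rmorph1 (real_complex R)) ltcR.
  have /andP[s0 s1] := sin01 t.
  rewrite normrM normc_real (ger0_norm s0); apply: le_trans (xr i).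
  by rewrite -[leRHS]mulr1 ler_wpM2l// -(rmorph1 (real_complex R)) lecR.
Unshelve. all: end_near. Qed.

End LauricellaIntegral.

(** * Substitution in integrals over open intervals *)

Section Substitution.
Variable R : realType.
Local Notation mu := (@lebesgue_measure R).

(** The integrand may blow up at the ends of the interval, as it does for the
    complete elliptic integral: exhaust the interval by compact ones and pass to
    the limit by monotone convergence on both sides. *)
Lemma ge0_integration_by_substitution_oo (F F' G : R -> R) (a b : R) : a < b ->
  (forall x : R, is_derive x 1 F (F' x)) -> continuous F' ->
  {in `]a, b[, forall x, 0 < F' x} ->
  {in `]F a, F b[, continuous G} -> {in `]F a, F b[, forall x, 0 <= G x} ->
  (\int[mu]_(x in `]F a, F b[) (G x)%:E =
   \int[mu]_(x in `]a, b[) (G (F x) * F' x)%:E)%E.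
Proof.
move=> ab dF cF' F'0 cG G0.
have cF := is_derive_continuous dF.
have F'E : derive1 F = F' by apply/funext => x; rewrite derive1E; have [_ ] := dF x.
have incF : {in `[a, b] &, {homo F : x y / x < y}}.
  apply: gtr0_derive1_lt_cc.
  - by move=> x _; have [] := dF x.
  - by move=> x xab; rewrite F'E F'0.
  - exact: continuous_subspaceT.
pose d n : R := (b - a) / n.+2%:R.
have d0 n : 0 < d n by rewrite divr_gt0// subr_gt0.
have dlt n : a + d n <= b - d n.
  have : d n * 2 <= b - a.
    rewrite -[leRHS](@divfK _ n.+2%:R) ?pnatr_eq0// ler_pM2l//.
    by rewrite ler_nat.
  by lra.
have d_anti m n : (m <= n)%N -> d n <= d m.
  by move=> mn; rewrite ler_pM2l ?subr_gt0// lef_pV2 ?posrE// ler_nat !ltnS.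
have d_small e : 0 < e -> exists n, d n <= e.
  move=> e0; have ba0 : 0 <= (b - a) / e by rewrite divr_ge0 ?subr_ge0 ?ltW.
  exists (Num.bound ((b - a) / e)); rewrite ler_pdivrMr// mulrC -ler_pdivrMr//.
  by apply: ltW; apply: lt_le_trans (archi_boundP ba0) _; rewrite ler_nat -addn2 leq_addr.
(* The compact intervals [A n] exhaust the domain and [B n] = F(A n) the image. *)
pose A n : set R := `[a + d n, b - d n]%classic.
pose B n : set R := `[F (a + d n), F (b - d n)]%classic.
have Aab n : A n `<=` `]a, b[%classic.
  move=> x; rewrite /A /= !in_itv/= => /andP[? ?]; have := d0 n.
  by move=> ?; apply/andP; split; lra.
have leF : {in `[a, b] &, {homo F : x y / x <= y}}.
  move=> x y xab yab; rewrite le_eqVlt => /predU1P[->//|xy].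
  by rewrite ltW// incF.
have inab x : a < x < b -> x \in `[a, b] by rewrite in_itv/= => /andP[/ltW-> /ltW->].
have adb n : a < a + d n < b /\ a < b - d n < b.
  by have := d0 n; have := dlt n => ? ?; split; apply/andP; split; lra.
have Fab x : a < x < b -> F a < F x < F b.
  move=> xab; have /andP[ax xb] := xab.
  have aab : a \in `[a, b] by rewrite in_itv/= lexx ltW.
  have bab : b \in `[a, b] by rewrite in_itv/= lexx ltW.
  by rewrite (incF _ _ aab (inab _ xab) ax) (incF _ _ (inab _ xab) bab xb).
have BFab n : B n `<=` `]F a, F b[%classic.
  move=> x; rewrite /B /= !in_itv/= => /andP[xa xb].
  have [/Fab/andP[h1 h2] /Fab/andP[h3 h4]] := adb n.
  by rewrite (lt_le_trans h1 xa) (le_lt_trans xb h4).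
have UA : \bigcup_n A n = `]a, b[%classic.
  apply/seteqP; split; first by move=> x [n _]; exact: Aab.
  move=> x; rewrite /= in_itv/= => /andP[ax xb].
  have [|n dn] := d_small (Num.min (x - a) (b - x)).
    by rewrite lt_min !subr_gt0 ax xb.
  exists n => //; rewrite /A /= in_itv/=; move: dn; rewrite le_min => /andP[? ?].
  by apply/andP; split; lra.
have UB : \bigcup_n B n = `]F a, F b[%classic.
  apply/seteqP; split; first by move=> x [n _]; exact: BFab.
  move=> y; rewrite /= in_itv/= => /andP[ay yb].
  have [x xab yE] : exists2 x, x \in `[a, b] & F x = y.
    apply: IVT; [exact: ltW | exact: continuous_subspaceT |].
    by rewrite minEle maxEle !(ltW (lt_trans ay yb)) !ltW.
  have : (\bigcup_n A n) x.
    rewrite UA /= in_itv/= !lt_neqAle; move: xab; rewrite in_itv/= => /andP[-> ->].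
    rewrite !andbT; apply/andP; split; apply/eqP => xE; move: ay yb.
      by rewrite -yE -xE ltxx.
    by rewrite -yE xE ltxx.
  move=> [n _]; rewrite /A /= in_itv/= => /andP[x1 x2]; exists n => //.
  have [/inab ? /inab ?] := adb n.
  by rewrite /B /= -yE in_itv/= !leF.
have mB n : measurable_fun (B n) (EFin \o G).
  apply: measurable_funS (BFab n) _ => //; apply/measurable_EFinP.
  apply: open_continuous_measurable_fun; first exact: interval_open.
  by move=> x /[!inE]; exact: cG.
have mA n : measurable_fun (A n) (EFin \o (fun x => G (F x) * F' x)).
  apply: measurable_funS (Aab n) _ => //; apply/measurable_EFinP.
  apply: open_continuous_measurable_fun; first exact: interval_open.
  move=> x /[!inE]/= xab; apply: cvgM; last exact: cF'.
  apply: (@continuous_comp _ _ _ F G); first exact: cF.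
  by apply: cG; rewrite in_itv/= Fab.
have cvgB : (\int[mu]_(x in B n) (G x)%:E @[n --> \oo] -->
    \int[mu]_(x in `]F a, F b[) (G x)%:E)%E.
  rewrite -UB; apply: ge0_nondecreasing_set_cvg_integral => //.
  - move=> m n mn; apply/subsetPset => x; rewrite /B/= !in_itv/= => /andP[x1 x2].
    have [/inab ? /inab ?] := adb n; have [/inab ? /inab ?] := adb m.
    have := d_anti _ _ mn => ?.
    rewrite (le_trans _ x1) ?(le_trans x2)//; apply: leF => //; lra.
  - by move=> n; exact: measurable_itv.
  - by move=> n x /BFab xF; rewrite lee_fin; exact: G0.
have cvgA : (\int[mu]_(x in A n) (G (F x) * F' x)%:E @[n --> \oo] -->
    \int[mu]_(x in `]a, b[) (G (F x) * F' x)%:E)%E.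
  rewrite -UA; apply: ge0_nondecreasing_set_cvg_integral => //.
  - move=> m n mn; apply/subsetPset => x; rewrite /A/= !in_itv/= => /andP[x1 x2].
    have := d_anti _ _ mn => ?; apply/andP; split; lra.
  - by move=> n; exact: measurable_itv.
  - move=> n x /Aab; rewrite /= => xab; rewrite lee_fin mulr_ge0//.
      by apply: G0; rewrite in_itv/= Fab.
    by rewrite ltW// F'0.
rewrite -(cvg_lim (@ereal_hausdorff R) cvgB) -(cvg_lim (@ereal_hausdorff R) cvgA).
congr (limn _); apply/funext => n.
rewrite /B (@integration_by_substitution_increasing R F G)//.
- by rewrite F'E.
- by move=> x y xA yA; apply: incF; rewrite inab//; [have := Aab n x xA | have := Aab n y yA].
- by move=> x _; rewrite F'E; exact: cF'.
- by rewrite F'E; apply: cvgP; apply: cvg_at_right_filter; exact: cF'.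
- by rewrite F'E; apply: cvgP; apply: cvg_at_left_filter; exact: cF'.
- split; [|apply: cvg_at_right_filter; exact: cF|apply: cvg_at_left_filter; exact: cF].
  by move=> x _; have [] := dF x.
- apply: continuous_in_subspaceT => x /[!inE] xB.
  by apply: cG; exact: BFab xB.
Qed.

Lemma ellipticK_substitution (k : R) (x dx g : R -> R) : `|k| < 1 ->
  (forall t : R, is_derive t 1 x (dx t)) -> continuous dx ->
  x 0 = 0 -> x (pi / 2) = 1 ->
  (forall t, 0 < t < pi / 2 -> 0 < dx t) ->
  continuous g ->
  (forall t, 0 < t < pi / 2 ->
    dx t = g t * Num.sqrt ((1 - x t ^+ 2) * (1 - k ^+ 2 * x t ^+ 2))) ->
  ellipticK k = \int[mu]_(t in `[0, pi / 2]) g t.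
Proof.
move=> k1 dxP cdx x0 x1 dx0 cg gE.
have k21 : k ^+ 2 < 1 by rewrite -real_normK ?num_real// expr_lt1.
pose w (y : R) := (1 - y ^+ 2) * (1 - k ^+ 2 * y ^+ 2).
have w0 y : 0 < y < 1 -> 0 < w y.
  move=> /andP[y0 y1].
  have y21 : y ^+ 2 < 1 by rewrite expr_lt1// ltW.
  have ky : k ^+ 2 * y ^+ 2 <= k ^+ 2 by rewrite ler_piMr ?sqr_ge0// ltW.
  by rewrite /w mulr_gt0// subr_gt0// (le_lt_trans ky).
have cw : continuous w.
  move=> y; apply: cvgM; apply: cvgB; try exact: cvg_cst; first exact: exprn_continuous.
  by apply: cvgM; [exact: cvg_cst | exact: exprn_continuous].
have cK : {in `](x 0), (x (pi / 2))[, continuous (fun y => (Num.sqrt (w y))^-1)}.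
  move=> y; rewrite x0 x1 in_itv/= => /w0 wy.
  apply: cvgV; first by rewrite gt_eqF// sqrtr_gt0.
  by apply: (@continuous_comp _ _ _ w (@Num.sqrt R)); [exact: cw | exact: sqrt_continuous].
have incx : {in `[0, pi / 2] &, {homo x : s t / s < t}}.
  apply: gtr0_derive1_lt_cc.
  - by move=> t _; have [] := dxP t.
  - by move=> t; rewrite in_itv/= => /dx0; rewrite derive1E; have [_ ->] := dxP t.
  - by apply: continuous_subspaceT; exact: is_derive_continuous dxP.
have x01 t : 0 < t < pi / 2 -> 0 < x t < 1.
  move=> /andP[t0 t1]; rewrite -x0 -x1.
  by rewrite !incx// ?in_itv/= ?lexx ?ltW ?pihalf_gt0.
rewrite /ellipticK /Rintegral; congr fine.
have := @ge0_integration_by_substitution_oo x dx (fun y => (Num.sqrt (w y))^-1)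
  0 (pi / 2) (pihalf_gt0 R) dxP cdx.
rewrite !x0 !x1 => ->.
- rewrite [RHS]integral_itv_bndoo; last first.
    by apply/measurable_EFinP; apply: measurable_funTS; exact: continuous_measurable_fun.
  apply: eq_integral => t; rewrite inE/= in_itv/= => t01.
  by rewrite gE// mulrCA mulVf ?mulr1// gt_eqF// sqrtr_gt0 w0// x01.
- by move=> t; rewrite in_itv/=; exact: dx0.
- by move: cK; rewrite x0 x1.
- by move=> y _; rewrite invr_ge0 sqrtr_ge0.
Qed.

End Substitution.

(** * The integrand and the two elliptic integrals *)

Section Kernel.
Variable R : realType.

Definition lin_factor (q S : R) := 1 - q ^+ 2 * S.

(** The squared modulus of 1 - q e^(i theta) S, where c is the cosine of theta. *)
Definition quad_factor (q c S : R) := 1 - 2 * q * c * S + q ^+ 2 * S ^+ 2.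

Definition lauricella_kernel (q c S : R) :=
  (Num.sqrt (lin_factor q S))^-1 * (Num.sqrt (quad_factor q c S))^-1.

Variables q c : R.
Hypotheses (q01 : 0 < q < 1) (c1 : -1 <= c <= 1).
Local Notation M := (lin_factor q).
Local Notation N := (quad_factor q c).
Local Notation H := (lauricella_kernel q c).

Lemma mul_lt1 S : 0 <= S <= 1 -> q * S < 1.
Proof.
move=> /andP[S0 S1]; move: q01 => /andP[q0 q1].
by rewrite (le_lt_trans _ q1)// ler_piMr// ltW.
Qed.

Lemma lin_factor_gt0 S : 0 <= S <= 1 -> 0 < M S.
Proof.
move=> /andP[S0 S1]; move: q01 => /andP[q0 q1].
have : q ^+ 2 * S <= q ^+ 2 by rewrite ler_piMr ?sqr_ge0.
have : q ^+ 2 < 1 by rewrite expr_lt1// ltW.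
by rewrite /lin_factor; lra.
Qed.

Lemma quad_factor_gt0 S : 0 <= S <= 1 -> 0 < N S.
Proof.
move=> S01; have [S0 S1] := andP S01; have [q0 q1] := andP q01.
have [c0' c1'] := andP c1.
have -> : N S = (1 - q * S) ^+ 2 + 2 * (q * S) * (1 - c).
  by rewrite /quad_factor; ring.
rewrite ltr_pwDl//; first by rewrite exprn_gt0// subr_gt0 mul_lt1.
by rewrite mulr_ge0 ?subr_ge0// mulr_ge0// mulr_ge0// ltW.
Qed.

Lemma quad_factor_le4 S : 0 <= S <= 1 -> N S <= 4.
Proof.
move=> S01; have [S0 S1] := andP S01; have [q0 q1] := andP q01.
have [c0' c1'] := andP c1.
have qS := mul_lt1 S01; have qS0 : 0 <= q * S by rewrite mulr_ge0// ltW.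
have -> : N S = (1 + q * S) ^+ 2 - 2 * (q * S) * (1 + c).
  by rewrite /quad_factor; ring.
have : 0 <= 2 * (q * S) * (1 + c).
  by rewrite mulr_ge0 ?mulr_ge0//; lra.
by nra.
Qed.

Lemma lauricella_kernel_ge S : 0 <= S <= 1 -> 2^-1 <= H S.
Proof.
move=> S01; have [S0 S1] := andP S01.
have M0 := lin_factor_gt0 S01; have N0 := quad_factor_gt0 S01.
have sM : Num.sqrt (M S) <= 1.
  by rewrite -sqrtr1 ler_sqrt// /lin_factor gerBl mulr_ge0// sqr_ge0.
have sN : Num.sqrt (N S) <= 2.
  have -> : 2 = Num.sqrt (2 ^+ 2) :> R by rewrite sqrtr_sqr ger0_norm.
  by rewrite ler_sqrt// (le_trans (quad_factor_le4 S01))// -natrX.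
have hM : 1 <= (Num.sqrt (M S))^-1 by rewrite invf_ge1 ?sqrtr_gt0.
have hN : 2^-1 <= (Num.sqrt (N S))^-1 by rewrite lef_pV2 ?posrE ?sqrtr_gt0.
by rewrite -[2^-1]mul1r; apply: ler_pM; rewrite ?invr_ge0.
Qed.

Lemma continuous_lin_factor : continuous M.
Proof.
rewrite (_ : M = horner (1 - (q ^+ 2)%:P * 'X)); first exact: continuous_horner.
by apply/funext => S; rewrite /lin_factor !hornerE.
Qed.

Lemma continuous_quad_factor : continuous N.
Proof.
rewrite (_ : N = horner (1 - (2 * q * c)%:P * 'X
  + (q ^+ 2)%:P * 'X^2)); first exact: continuous_horner.
by apply/funext => S; rewrite /quad_factor !hornerE.
Qed.

Lemma continuous_kernel_sin2 : continuous (fun t : R => H (sin t ^+ 2)).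
Proof.
have inv (f : R -> R) : continuous f -> (forall S : R, 0 <= S <= 1 -> 0 < f S) ->
    continuous (fun t : R => (Num.sqrt (f (sin t ^+ 2)))^-1).
  move=> cf f0; apply: continuous_inv_fun => [t|].
    by rewrite sqrtr_gt0 f0 ?sin2_01.
  exact/continuous_sqrt_fun/continuous_comp_sin2.
move=> t; apply: cvgM.
  exact: inv continuous_lin_factor lin_factor_gt0 _.
exact: inv continuous_quad_factor quad_factor_gt0 _.
Qed.

Lemma continuous_affine_kernel (d : R) :
  continuous (fun t : R => (1 + d * sin t ^+ 2) * H (sin t ^+ 2)).
Proof.
move=> t; apply: cvgM; last exact: continuous_kernel_sin2.
apply: cvgD; first exact: cvg_cst.
by apply: cvgM; [exact: cvg_cst | exact: continuous_sinX].
Qed.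

End Kernel.

Section EllipticIntegrals.
Variable R : realType.
Local Notation mu := (@lebesgue_measure R).
Variables (u q c C s : R).
Hypotheses (u01 : 0 < u < 1) (qE : q = u ^+ 2).
Hypotheses (Cs : C ^+ 2 + s ^+ 2 = 1) (cE : c = C ^+ 2 - s ^+ 2).
Local Notation M := (lin_factor q).
Local Notation N := (quad_factor q c).
Local Notation H := (lauricella_kernel q c).

Let q01 : 0 < q < 1.
Proof. by move: u01 => /andP[u0 u1]; rewrite qE exprn_gt0//= expr_lt1// ltW. Qed.

Let c1 : -1 <= c <= 1.
Proof.
have := sqr_ge0 C; have := sqr_ge0 s; move: Cs; rewrite cE => *.
by apply/andP; split; lra.
Qed.

Let M_gt0 := lin_factor_gt0 q01.
Let N_gt0 := quad_factor_gt0 q01 c1.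
Let qS_lt1 := mul_lt1 q01.

(** Gauss's form of the Landen substitution,
    x = (1 + q) sin t / (1 + q sin^2 t). With S = sin^2 t and A = 1 + q S,
    1 - x^2 = cos^2 t M(S) / A^2 and 1 - k^2 x^2 = N(S) / A^2. *)
Lemma ellipticK_cos_modulus : ellipticK (2 * u * C / (1 + q)) =
  \int[mu]_(t in `[0, pi / 2])
    ((1 + q) * ((1 - q * sin t ^+ 2) * H (sin t ^+ 2))).
Proof.
have [q0 q1] := andP q01; have [u0 u1] := andP u01.
have q10 : 1 + q != 0 by rewrite gt_eqF// ltr_wpDr// ltW.
have A0 (t : R) : 0 < 1 + q * sin t ^+ 2.
  by rewrite ltr_wpDr// mulr_ge0 ?sqr_ge0// ltW.
have dA (t : R) : is_derive t 1 (fun t => 1 + q * sin t ^+ 2) (2 * q * sin t * cos t).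
  have -> : (fun t : R => 1 + q * sin t ^+ 2)
      = (fun t => (1 + q%:P * 'X).[sin t ^+ 2]).
    by apply/funext => y; rewrite !hornerE.
  apply: (is_derive_eq (is_derive_sin2 _ t)); rewrite !poly.derivE !hornerE/=.
  by ring.
apply: (@ellipticK_substitution R _ (fun t => (1 + q) * (sin t * (1 + q * sin t ^+ 2)^-1))
  (fun t => (1 + q) * (cos t * (1 - q * sin t ^+ 2) * (1 + q * sin t ^+ 2)^-2))
  (fun t => (1 + q) * ((1 - q * sin t ^+ 2) * H (sin t ^+ 2)))).
- have C1 : `|C| <= 1.
    by rewrite -(@expr_le1 _ 2)// real_normK ?num_real// -Cs lerDl sqr_ge0.
  have q1p : 0 < 1 + q by rewrite addr_gt0.
  rewrite normf_div (gtr0_norm q1p) ltr_pdivrMr//.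
  rewrite mul1r !normrM normr_nat (gtr0_norm u0).
  have : 0 < (1 - u) ^+ 2 by rewrite exprn_gt0// subr_gt0.
  have : u * `|C| <= u by rewrite ler_piMr// ltW.
  by rewrite qE; nra.
- move=> t; have h := is_deriveM_fun (is_derive_sin t)
    (@is_deriveV_fun R (fun t => 1 + q * sin t ^+ 2) t _ (lt0r_neq0 (A0 t)) (dA t)).
  apply: (is_derive_eq (is_deriveZ (1 + q) h)); congr (_ * _).
  have Ane := lt0r_neq0 (A0 t).
  by field.
- have cA : continuous (fun t : R => 1 + q * sin t ^+ 2).
    exact: is_derive_continuous dA.
  move=> t; apply: cvgM; first exact: cvg_cst.
  apply: cvgM.
    apply: cvgM; first exact: continuous_cos.
    apply: cvgB; first exact: cvg_cst.
    by apply: cvgM; [exact: cvg_cst | exact: continuous_sinX].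
  apply: (@continuous_inv_fun R (fun t : R => (1 + q * sin t ^+ 2) ^+ 2)) => [x|].
    by rewrite exprn_gt0.
  exact: continuous_exp_fun.
- by rewrite sin0 mul0r mulr0.
- by rewrite sin_pihalf expr1n mulr1 mul1r divff.
- move=> t t01; have c0 := cos_gt0_quarter t01.
  apply: mulr_gt0; first by rewrite addr_gt0.
  apply: mulr_gt0; last by rewrite invr_gt0 exprn_gt0.
  by rewrite mulr_gt0// subr_gt0 qS_lt1 ?sin2_01.
- have := continuous_affine_kernel q01 c1 (d := - q).
  under eq_fun do rewrite mulNr.
  by move=> cH t; apply: cvgM; [exact: cvg_cst | exact: cH].
- move=> t t01; have c0 := cos_gt0_quarter t01.
  have Ane := lt0r_neq0 (A0 t).
  have M0 := M_gt0 (sin2_01 t); have N0 := N_gt0 (sin2_01 t).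
  set m := Num.sqrt (M (sin t ^+ 2)); set n := Num.sqrt (N (sin t ^+ 2)).
  have m0 : 0 < m by rewrite sqrtr_gt0.
  have n0 : 0 < n by rewrite sqrtr_gt0.
  have mE : m ^+ 2 = M (sin t ^+ 2) by rewrite sqr_sqrtr// ltW.
  have nE : n ^+ 2 = N (sin t ^+ 2) by rewrite sqr_sqrtr// ltW.
  set X := (X in Num.sqrt X).
  have XE : X = (cos t * m * n / (1 + q * sin t ^+ 2) ^+ 2) ^+ 2.
    rewrite !exprMn exprVn mE nE cos2sin2 /X /lin_factor /quad_factor cE qE.
    have -> : s ^+ 2 = 1 - C ^+ 2 by rewrite -Cs; ring.
    by field; rewrite exprMn -qE Ane q10.
  rewrite XE sqrtr_sqr ger0_norm; last first.
    by rewrite !mulr_ge0 ?invr_ge0 ?exprn_ge0 ?ltW.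
  rewrite /lauricella_kernel -/m -/n; field.
  by rewrite Ane !lt0r_neq0.
Qed.

(** The companion substitution x = D sin t / sqrt N(S): here
    1 - x^2 = cos^2 t M(S) / N(S) and 1 - k^2 x^2 = (1 - q S)^2 / N(S). *)
Lemma ellipticK_sin_modulus : let D := Num.sqrt (N 1) in
  ellipticK (2 * u * s / D) =
  \int[mu]_(t in `[0, pi / 2])
    (D * ((1 + q * sin t ^+ 2) * H (sin t ^+ 2))).
Proof.
move=> D; have [q0 q1] := andP q01; have [u0 u1] := andP u01.
have N10 : 0 < N 1 by rewrite N_gt0// ler01 lexx.
have D0 : 0 < D by rewrite sqrtr_gt0.
have D2 : D ^+ 2 = N 1 by rewrite sqr_sqrtr// ltW.
have s2 : s ^+ 2 = 1 - C ^+ 2 by rewrite -Cs; ring.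
pose n (t : R) := Num.sqrt (N (sin t ^+ 2)).
have NS0 (t : R) : 0 < N (sin t ^+ 2) by rewrite N_gt0 ?sin2_01.
have n0 t : 0 < n t by rewrite sqrtr_gt0.
have n2 t : n t ^+ 2 = N (sin t ^+ 2) by rewrite sqr_sqrtr// ltW.
pose N' (S : R) := - (2 * q * c) + 2 * q ^+ 2 * S.
have dN (t : R) : is_derive t 1 (fun t => N (sin t ^+ 2))
    (N' (sin t ^+ 2) * (2 * sin t * cos t)).
  have -> : (fun t : R => N (sin t ^+ 2)) = (fun t =>
      (1 - (2 * q * c)%:P * 'X + (q ^+ 2)%:P * 'X^2).[sin t ^+ 2]).
    by apply/funext => y; rewrite /quad_factor !hornerE.
  apply: (is_derive_eq (is_derive_sin2 _ t)); rewrite !poly.derivE !hornerE/= /N'.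
  by ring.
have dn (t : R) : is_derive t 1 n
    ((2 * n t)^-1 * (N' (sin t ^+ 2) * (2 * sin t * cos t))).
  exact: (@is_derive1_comp R (@Num.sqrt R) (fun t => N (sin t ^+ 2)) t _ _
    (is_derive1_sqrt (NS0 t)) (dN t)).
have cn : continuous n by exact: is_derive_continuous dn.
apply: (@ellipticK_substitution R _ (fun t => D * (sin t * (n t)^-1))
  (fun t => D * (cos t * (1 - q ^+ 2 * sin t ^+ 4) * (n t ^+ 3)^-1))
  (fun t => D * ((1 + q * sin t ^+ 2) * H (sin t ^+ 2)))).
- rewrite -(@expr_lt1 _ 2)// real_normK ?num_real// expr_div_n D2.
  rewrite ltr_pdivrMr// mul1r -subr_gt0.
  have -> : N 1 - (2 * u * s) ^+ 2 = (1 - q) ^+ 2.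
    by rewrite exprMn s2 /quad_factor cE qE s2; ring.
  by rewrite exprn_gt0// subr_gt0.
- move=> t; have h := is_deriveM_fun (is_derive_sin t)
    (is_deriveV_fun (lt0r_neq0 (n0 t)) (dn t)).
  apply: (is_derive_eq (is_deriveZ D h)); congr (_ * _).
  have nne := lt0r_neq0 (n0 t).
  transitivity (cos t * (n t ^+ 2 - sin t ^+ 2 * N' (sin t ^+ 2)) * (n t ^+ 3)^-1).
    by field.
  by congr (_ * _ * _); rewrite n2 /quad_factor /N'; ring.
- move=> t; apply: cvgM; first exact: cvg_cst.
  apply: cvgM.
    apply: cvgM; first exact: continuous_cos.
    apply: cvgB; first exact: cvg_cst.
    by apply: cvgM; [exact: cvg_cst | exact: continuous_sinX].
  apply: (@continuous_inv_fun R (fun t : R => n t ^+ 3)) => [x|].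
    by rewrite exprn_gt0.
  exact: continuous_exp_fun.
- by rewrite sin0 mul0r mulr0.
- by rewrite /n sin_pihalf expr1n mul1r divff// lt0r_neq0.
- move=> t t01.
  apply: mulr_gt0 => //; apply: mulr_gt0; last by rewrite invr_gt0 exprn_gt0.
  apply: mulr_gt0; first exact: cos_gt0_quarter.
  have := qS_lt1 (sin2_01 t); have := sin2_01 t => /andP[S0 _] qS.
  rewrite subr_gt0 (_ : q ^+ 2 * sin t ^+ 4 = (q * sin t ^+ 2) ^+ 2); last by ring.
  by rewrite expr_lt1// mulr_ge0// ltW.
- by move=> t; apply: cvgM; [exact: cvg_cst | exact: (continuous_affine_kernel q01 c1)].
- move=> t t01; have c0 := cos_gt0_quarter t01.
  have nne := lt0r_neq0 (n0 t).
  have M0 := M_gt0 (sin2_01 t).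
  have [S0 _] := andP (sin2_01 t).
  have qS := qS_lt1 (sin2_01 t).
  set m := Num.sqrt (M (sin t ^+ 2)).
  have m0 : 0 < m by rewrite sqrtr_gt0.
  have mE : m ^+ 2 = M (sin t ^+ 2) by rewrite sqr_sqrtr// ltW.
  set X := (X in Num.sqrt X).
  have XE : X = (cos t * m * (1 - q * sin t ^+ 2) / n t ^+ 2) ^+ 2.
    have -> : X = (n t ^+ 2 - N 1 * sin t ^+ 2)
        * (n t ^+ 2 - 4 * q * s ^+ 2 * sin t ^+ 2) / (n t ^+ 2) ^+ 2.
      rewrite /X -D2 qE; field.
      by rewrite nne lt0r_neq0.
    rewrite [RHS]exprMn exprVn; congr (_ / _).
    by rewrite !exprMn mE cos2sin2 n2 /lin_factor /quad_factor cE s2; ring.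
  rewrite XE sqrtr_sqr ger0_norm; last first.
    rewrite divr_ge0 ?exprn_ge0 ?(ltW (n0 t))//.
    by rewrite !mulr_ge0 ?subr_ge0 ?(ltW qS) ?(ltW m0) ?(ltW c0).
  rewrite /lauricella_kernel -/m -/(n t); field.
  by rewrite nne lt0r_neq0.
Qed.

(** The numerators 1 - q S and 1 + q S of the two integrands add up to 2. *)
Lemma ellipticK_sum : let D := Num.sqrt (N 1) in
  ellipticK (2 * u * C / (1 + q)) / (1 + q) + ellipticK (2 * u * s / D) / D
  = 2 * \int[mu]_(t in `[0, pi / 2]) H (sin t ^+ 2).
Proof.
move=> D; have [q0 q1] := andP q01.
have q1p : 1 + q != 0 by rewrite gt_eqF// addr_gt0.
have D0 : D != 0 by rewrite gt_eqF// sqrtr_gt0 N_gt0// ler01 lexx.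
have iA d := @continuous_integrable_itvcc R _ 0 (pi / 2)
  (@continuous_affine_kernel R q c q01 c1 d).
rewrite ellipticK_cos_modulus ellipticK_sin_modulus.
under eq_Rintegral do rewrite -mulNr.
rewrite !RintegralZl//; [|exact: iA..].
rewrite [(1 + q) * _]mulrC [D * _]mulrC !mulfK// -RintegralD//; [|exact: iA..].
rewrite -RintegralZl//; last first.
  exact/continuous_integrable_itvcc/continuous_kernel_sin2.
by apply: eq_Rintegral => t _; ring.
Qed.

End EllipticIntegrals.

(** * The Lauricella function of the theorem as an integral *)

Section LauricellaKernel.
Variable R : realType.
Local Notation mu := (@lebesgue_measure R).

(** For conjugate arguments z and z^* the two Taylor polynomials multiply to a
    squared modulus, which tends to the inverse of the modulus of 1 - z S. *)
Lemma lauricella_conj_pair (q c d : R) : 0 < q < 1 -> c ^+ 2 + d ^+ 2 = 1 ->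
  lauricellaFD 2^-1 [tuple 2^-1; 2^-1; 2^-1] 1
    [tuple (q ^+ 2)%:C; (q * c) -i* (q * d); (q * c) +i* (q * d)]
  = (2 / pi * \int[mu]_(t in `[0, pi / 2]) lauricella_kernel q c (sin t ^+ 2))%:C.
Proof.
move=> q01 cd; have /andP[q0 q1] := q01.
have [z zE] : {z : R[i] | z = (q * c) -i* (q * d)} by exists ((q * c) -i* (q * d)).
have [z' zJ] : {z' : R[i] | z' = z^*} by exists z^*.
have -> : (q * c) +i* (q * d) = z' by rewrite zJ zE/= opprK.
rewrite -zE.
have zq : `|z| = q%:C.
  rewrite zE normc_def/= (_ : _ + _ = q ^+ 2); first by rewrite sqrtr_sqr gtr0_norm.
  by rewrite sqrrN !exprMn -mulrDr cd mulr1.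
have zq' : `|z'| = q%:C.
  by rewrite zJ -zq !normc_def; case: (z) => ? ? /=; rewrite sqrrN.
apply: (@lauricella_half_integral R 3 _ _ q
  (fun N S => (half_poly R N).[q ^+ 2 * S]
     * complex.Re `|(half_poly R[i] N).[z * S%:C]| ^+ 2)).
- by case=> -[|[|[|]]].
- move=> i; case: i => -[|[|[|m]]] im //; rewrite /tnth [nth _ _ _]/=.
  + rewrite normc_real lecR gtr0_norm ?exprn_gt0// -[leRHS]mulr1 expr2.
    by rewrite ler_wpM2l ?ltW.
  + by rewrite zq.
  + by rewrite zq'.
- by rewrite ltW.
- move=> N S; rewrite !big_ord_recl big_ord0/= /tnth/= mulr1.
  have -> : z' * S%:C = (z * S%:C)^* by rewrite zJ rmorphM/= oppr0.
  have -> w : (half_poly R[i] N).[w^*] = ((half_poly R[i] N).[w])^*.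
    by rewrite -(map_half_poly (@conjc R)).
  rewrite [RHS]rmorphM; congr (_ * _).
    by rewrite [RHS](map_half_poly (real_complex R)) [in RHS]rmorphM.
  have nE (w : R[i]) : (complex.Re `|w| ^+ 2)%:C = `|w| ^+ 2.
    by rewrite -{2}(RRe_real (normr_real w)) -rmorphXn.
  apply: etrans (esym (nE _)).
  case: (_.[_]) => x y; rewrite -add_Re2_Im2/=.
  by apply/eqP; rewrite eq_complex/=; apply/andP; split; apply/eqP; ring.
- move=> S /andP[S0 S1].
  have qS : q * S <= q by rewrite ler_piMr// ltW.
  have q2S : 0 <= q ^+ 2 * S < 1.
    by rewrite mulr_ge0 ?sqr_ge0//= expr2 -mulrA; nra.
  apply: cvgM; first exact: half_poly_cvg.
  have -> : Num.sqrt (quad_factor q c S) = complex.Re `|1 - z * S%:C|.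
    rewrite normc_def zE/=; congr Num.sqrt.
    transitivity (1 - 2 * q * c * S + q ^+ 2 * S ^+ 2 * (c ^+ 2 + d ^+ 2)); last by ring.
    by rewrite cd mulr1.
  have zSq : `|z * S%:C| <= q%:C.
    by rewrite normrM zq normc_real ger0_norm// -rmorphM lecR.
  exact: half_poly_cvg_norm zSq q1.
- apply: continuous_kernel_sin2 => //.
  have := sqr_ge0 d; rewrite -(addKr (c ^+ 2) (d ^+ 2)) cd addrC subr_ge0.
  by rewrite -real_normK ?num_real// expr_le1// ler_norml.
Qed.

(** The Lauricella value is a denominator in the theorem, so it must not vanish. *)
Lemma kernel_integral_gt0 (q c : R) : 0 < q < 1 -> -1 <= c <= 1 ->
  0 < \int[mu]_(t in `[0, pi / 2]) lauricella_kernel q c (sin t ^+ 2).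
Proof.
move=> q01 c1.
have w0 : \int[mu]_(t in `[0, pi / 2]) (2^-1 * sin t ^+ 0.*2) = 2^-1 * (pi / 2).
  rewrite RintegralZl//; last exact/continuous_integrable_itvcc/continuous_sinX.
  by rewrite wallis half_coef0 mulr1.
apply: (@lt_le_trans _ _ (2^-1 * (pi / 2))).
  by rewrite mulr_gt0 ?invr_gt0 ?pihalf_gt0.
rewrite -w0; apply: le_Rintegral => //.
- apply: continuous_integrable_itvcc => t.
  by apply: cvgM; [exact: cvg_cst | exact: continuous_sinX].
- exact/continuous_integrable_itvcc/continuous_kernel_sin2.
- by move=> t _; rewrite expr0 mulr1 lauricella_kernel_ge// sin2_01.
Qed.

End LauricellaKernel.

Theorem theorem3p9 (R : realType) (a b : R) (hb : 1 < b) :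
  (pi : R)%:C =
    (b ^+ 2)%:C
    / lauricellaFD 2^-1 [tuple 2^-1; 2^-1; 2^-1] 1
        [tuple (1 / b ^+ 4)%:C;
               cexp ((- (2 * a)) *i) / (b ^+ 2)%:C;
               cexp ((2 * a) *i) / (b ^+ 2)%:C]
    * (ellipticK (2 * b * cos a / (1 + b ^+ 2)) / (1 + b ^+ 2)
       + ellipticK (2 * b * sin a
                    / Num.sqrt (1 - 2 * b ^+ 2 * cos (2 * a) + b ^+ 4))
         / Num.sqrt (1 - 2 * b ^+ 2 * cos (2 * a) + b ^+ 4))%:C.
Proof.
have b0 : 0 < b by rewrite (lt_trans _ hb).
have bne : b != 0 by rewrite gt_eqF.
have u01 : 0 < b^-1 < 1 by rewrite invr_gt0 b0 invf_lt1.
set q := b^-1 ^+ 2.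
have qE : q = b^-1 ^+ 2 by [].
have q01 : 0 < q < 1.
  by have /andP[u0 u1] := u01; rewrite /q exprn_gt0//= expr_lt1// ltW.
set c := cos (2 * a); set d := sin (2 * a).
have cE : c = cos a ^+ 2 - sin a ^+ 2.
  by rewrite /c mulr_natl cos_mulr2n sin2cos2; ring.
have cd : c ^+ 2 + d ^+ 2 = 1 by exact: cos2Dsin2.
have c1 : -1 <= c <= 1 by rewrite cos_geN1 cos_le1.
have -> : (1 / b ^+ 4)%:C = (q ^+ 2)%:C.
  by congr (_%:C); rewrite /q -exprM exprVn div1r.
have cexpE (y : R) : cexp (y *i) / (b ^+ 2)%:C = (q * cos y) +i* (q * sin y).
  rewrite /cexp /= expR0 mul1r -fmorphV/= /q exprVn.
  by apply/eqP; rewrite eq_complex/=; apply/andP; split; apply/eqP; ring.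
rewrite !cexpE cosN sinN mulrN lauricella_conj_pair//.
set I := \int[_]_(_ in _) _.
have I0 : I != 0 by rewrite gt_eqF// kernel_integral_gt0.
have pi0 : pi != 0 :> R by rewrite gt_eqF// pi_gt0.
have := ellipticK_sum u01 qE (cos2Dsin2 a) cE; rewrite -/I /=.
set D := Num.sqrt (quad_factor q c 1) => sumK.
have D0 : D != 0.
  by rewrite gt_eqF// sqrtr_gt0 quad_factor_gt0// ler01 lexx.
have -> : Num.sqrt (1 - 2 * b ^+ 2 * c + b ^+ 4) = b ^+ 2 * D.
  have -> : 1 - 2 * b ^+ 2 * c + b ^+ 4 = (b ^+ 2) ^+ 2 * quad_factor q c 1.
    by rewrite /quad_factor /q; field.
  by rewrite sqrtrM ?sqr_ge0// sqrtr_sqr ger0_norm// sqr_ge0.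
have q1 : 1 + q != 0 by rewrite gt_eqF// addr_gt0//; case/andP: q01.
have b21 : 1 + b ^+ 2 != 0 by rewrite gt_eqF// addr_gt0// exprn_gt0.
have -> : 2 * b * cos a / (1 + b ^+ 2) = 2 * b^-1 * cos a / (1 + q).
  by rewrite /q; field; rewrite bne addrC b21.
have -> : 2 * b * sin a / (b ^+ 2 * D) = 2 * b^-1 * sin a / D.
  by field; rewrite D0 bne.
set K1 := ellipticK _ in sumK *; set K2 := ellipticK _ in sumK *.
have -> : K1 / (1 + b ^+ 2) + K2 / (b ^+ 2 * D) = 2 * I / b ^+ 2.
  by rewrite -sumK /q; field; rewrite D0 bne addrC b21.
rewrite -fmorphV -!rmorphM/=; congr (_%:C).
(* Stated for an arbitrary p because [field] would unfold pi. *)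
have cancel (p i : R) : p != 0 -> i != 0 ->
    p = b ^+ 2 / (2 / p * i) * (2 * i / b ^+ 2).
  by move=> p0 i0; field; rewrite bne p0 i0.
exact: cancel.
Qed.
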